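(* The matrix $A$ is diagonalizable, with eigenvalues $\{\theta_i\}_{i\in[N]}$ (that is, the set of eigenvalues of $A$ is exactly $\{\theta_i : i\in [N]\}$), where $[N]=\{0,1/2,1,3/2,\ldots,N\}$ and $$\theta_i=\frac{q^{N-i}-q^i}{q-1}\,q^{M/2}\qquad (i\in[N]).$$
   Context: Let $\mathbb F_q$ be a finite field with $q$ elements, let $N,M$ be positive integers, let $H$ be a vector space over $\mathbb F_q$ of dimension $N+M$, and fix a subspace $h\subseteq H$ of dimension $M$. Let $X$ be the set of subspaces $y\subseteq H$ with $y\cap h=0$, partially ordered by inclusion (the Attenuated Space poset $\mathcal A_q(N,M)$). For $y,z\in X$, $z$ covers $y$ when $y\subseteq z$ and $\dim z-\dim y=1$; $y,z$ are adjacent when one of them covers the other. Let $\mathrm{Mat}_X(\mathbb C)$ be the algebra of complex matrices with rows and columns indexed by $X$, acting on $V=\mathbb C^X$ by left multiplication. The $q$-adjacency matrix $A\in\mathrm{Mat}_X(\mathbb C)$ has $(y,z)$-entry $1$ if $y$ covers $z$; $q^{\dim y}$ if $z$ covers $y$; and $0$ if $y,z$ are not adjacent. Here $[N]=\{i: 2i\in\mathbb Z,\ 0\le i\le N\}$, and $q^{1/2}$ denotes the positive square root of $q$. *)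

(* Defs.v *)
From HB Require Import structures.
From mathcomp Require Import all_boot all_order all_algebra.
From mathcomp Require Import complex.
From mathcomp Require Import reals exp.

Set Implicit Arguments.
Unset Strict Implicit.
Unset Printing Implicit Defensive.

Import Order.TTheory GRing.Theory Num.Theory.

Local Open Scope ring_scope.

(* Over a finite field, subspaces are finite in number; the library only     *)
(* provides the choiceType structure on {vspace H}.                          *)
Section VspaceFinite.
Import VectorInternalTheory.
Variables (F : finFieldType) (H : vectType F).
HB.instance Definition _ := [Countable of {vspace H} by <:].
HB.instance Definition _ := [Finite of {vspace H} by <:].
End VspaceFinite.

Section AttenuatedSpace.
Variables (F : finFieldType) (H : vectType F) (h : {vspace H}).

Definition att_space : {set {vspace H}} :=
  [set y : {vspace H} | (y :&: h == 0)%VS].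

Definition covers (z y : {vspace H}) : bool :=
  (y <= z)%VS && (\dim z == (\dim y).+1).

Variable R : realType.

Definition q_adjacency : 'M[R[i]]_#|att_space| :=
  \matrix_(a, b)
    let y := enum_val a in let z := enum_val b in
    if covers y z then 1
    else if covers z y then #|F|%:R ^+ \dim y
    else 0.

End AttenuatedSpace.

Definition half_int_range (R : realType) (N : nat) : pred R :=
  [pred i : R | (2 * i \is a Num.int) && (0 <= i <= N%:R)].

(* The half-integer powers are real powers, so q `^ 2^-1 is the positive     *)
(* square root of q.                                                         *)
Definition theta (R : realType) (q N M : nat) (i : R) : R :=
  (q%:R `^ (N%:R - i) - q%:R `^ i) / (q%:R - 1) * q%:R `^ (M%:R / 2).

(* Main.v *)
Require Import Defs.
From mathcomp Require Import all_boot all_order all_algebra.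
From mathcomp Require Import complex.
From mathcomp Require Import reals exp.
From mathcomp Require Import finfield ring lra.

(* Let A act on functions on X. For u in X and a function G on subspaces, the  *)
(* function y |-> [u <= y] G (y + h) is mapped by A to the function of the     *)
(* same shape given by the q-adjacency operator of the lattice [u + h, H]      *)
(* applied to G, plus functions of that shape attached to hyperplanes of u.    *)
(* Hence every eigenvalue of A is one of the operator of some [s, H] with      *)
(* h <= s, and the latter is triangular in the basis                           *)
(* w |-> t ^ (dim w) [z <= w], t = q ^ (dim s / 2 - dim z), with the values    *)
(* theta on the diagonal. Conversely, u = 0 gives the eigenvalues of integer   *)
(* index, and the difference of two lines u1, u2 with u1 + h = u2 + h, for     *)
(* which the extra terms cancel, gives those of half-integer index.            *)
(* Finally A is symmetrized by the weights q ^ (binomial (dim y) 2 / 2), so it *)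
(* is diagonalizable.                                                          *)

(** In this outline put [r = \dim u], so that [s = u + h] has dimension [r + M], and let
    [k = \dim z]. The diagonal value [interval_theta] is then [theta] at [i = k - M - r / 2]
    ([interval_thetaE]), and [r + M <= k <= N + M] places [i] between [r / 2] and [N - r / 2].

    That no other eigenvalue occurs is shown on left eigenvectors: each is paired with the functions
    above, and one of minimal dimension with nonzero pairing is chosen, so that the correction
    terms, attached to hyperplanes, drop out. This is done once for [u] ([att_op_eigenvalue]) and
    once for [z] ([interval_op_eigenvalue]).

    For the converse, the operator of [[s, H]] is restricted to functions of the dimension, where it
    is bidiagonal and has explicit eigenvectors ([tridiag_eigenvector]). They are lifted to the
    attenuated space with [r = 0] ([att_op_eigenvector_int]) and [r = 1]
    ([att_op_eigenvector_half]). *)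

Set Implicit Arguments.
Unset Strict Implicit.
Unset Printing Implicit Defensive.

Import Order.TTheory GRing.Theory Num.Theory.

Local Open Scope ring_scope.

(** * Counting subspaces *)

Section Counting.
Variables (F : finFieldType) (H : vectType F).
Implicit Types s u w x y z : {vspace H}.
Local Notation q := #|F|.
Local Notation fH := (finvect_type H).

Lemma card_setv y : #|[set v : fH | v \in y]| = (q ^ \dim y)%N.
Proof.
rewrite cardsE; case: H y => T cT y.
exact: (@card_vspace F (finvect_type (Vector.Pack cT)) cT y).
Qed.

Lemma card_setDv y w : (y <= w)%VS ->
  #|[set v : fH | v \in w & v \notin y]| = (q ^ \dim w - q ^ \dim y)%N.
Proof.
move=> /subvP yw; rewrite -!card_setv -cardsDS; last first.
  by apply/subsetP=> v; rewrite !inE; apply: yw.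
by apply: eq_card => v; rewrite !inE andbC.
Qed.

Lemma double_counting (T1 T2 : finType) (A : {set T1}) (B : {set T2}) (r : T1 -> T2 -> bool) :
  (\sum_(a in A) #|[set b in B | r a b]| = \sum_(b in B) #|[set a in A | r a b]|)%N.
Proof.
under eq_bigr do rewrite -sum1_card.
under [RHS]eq_bigr do rewrite -sum1_card.
rewrite (exchange_big_dep (mem B)) /=; last by move=> a b _; rewrite inE => /andP[].
by apply: eq_bigr => b bB; apply: eq_bigl => a; rewrite !inE bB.
Qed.

(** The q-analogue of the integer [n], that is, the number of lines in a space of dimension [n]. *)
Definition gauss_int (n : nat) : nat := \sum_(i < n) q ^ i.

Lemma gauss_intE n : ((q - 1) * gauss_int n = q ^ n - 1)%N.
Proof. by rewrite !subn1 predn_exp. Qed.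

Lemma card_field_gt1 : (1 < q)%N.
Proof. exact: finNzRing_gt1. Qed.

Lemma dim_add_line y (v : H) : v \notin y -> \dim (y + <[v]>) = (\dim y).+1.
Proof.
move=> vy; have v0 : v != 0 by apply: contraNneq vy => ->; exact: mem0v.
rewrite dimv_disjoint_sum ?dim_vline ?v0 ?addn1 //.
apply/eqP; rewrite -subv0; apply/subvP => x /memv_capP[xy /vlineP[a xa]].
rewrite memv0 xa; have [->|a0] := eqVneq a 0; first by rewrite scale0r.
by move: vy; rewrite -[v](scalerK a0) -xa memvZ.
Qed.

Lemma memv_add_line y (v : H) : v \in (y + <[v]>)%VS.
Proof. by rewrite memvE addvSr. Qed.

Lemma sub_add_line y w (v : H) :
  (y + <[v]> <= w)%VS = (y <= w)%VS && (v \in w).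
Proof. by rewrite subv_add memvE. Qed.

Lemma covers_line y (v : H) : v \notin y -> covers (y + <[v]>)%VS y.
Proof. by move=> vy; rewrite /covers addvSl dim_add_line /=. Qed.

Lemma covers_lineE x y (v : H) : covers x y -> v \notin y ->
  (v \in x) = (x == (y + <[v]>)%VS).
Proof.
move=> /andP[yx /eqP dx] vy; apply/idP/eqP => [vx|->]; last first.
  exact: memv_add_line.
apply/eqP; rewrite eq_sym eqEdim dim_add_line // dx leqnn andbT.
by rewrite sub_add_line yx vx.
Qed.

Lemma card_covers_through y w (v : H) : (y <= w)%VS -> v \in w -> v \notin y ->
  #|[set x in [set x | covers x y & (x <= w)%VS] | v \in x]| = 1%N.
Proof.
move=> yw vw vy; apply/eqP/cards1P; exists (y + <[v]>)%VS.
apply/setP => x; rewrite !inE; apply/idP/eqP => [/andP[/andP[cx xw]]|->].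
  by rewrite (covers_lineE cx vy) => /eqP.
by rewrite covers_line // memv_add_line sub_add_line yw vw.
Qed.

Lemma card_covers_ge_through s w (v : H) :
  #|[set x in [set x | covers w x & (s <= x)%VS] | v \in x]| =
  #|[set x | covers w x & (s + <[v]> <= x)%VS]|.
Proof. by apply: eq_card => x; rewrite !inE -andbA sub_add_line. Qed.

(** Double counting of pairs [v \in x] with [v] in [w] but not in [y]: such a [v] lies in the single
    cover [y + <[v]>], and each cover contains [q ^ (\dim y).+1 - q ^ \dim y] of them. *)
Lemma card_covers_le y w : (y <= w)%VS ->
  #|[set x | covers x y & (x <= w)%VS]| = gauss_int (\dim w - \dim y).
Proof.
move=> yw; set S := [set x | _ & _].
have := double_counting [set v : fH | v \in w & v \notin y] S
  (fun v x => v \in x).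
rewrite (eq_bigr (fun=> 1%N)) => [|v]; last first.
  by rewrite inE => /andP[vw vy]; exact: card_covers_through.
rewrite [X in _ = X -> _](eq_bigr (fun=> q ^ (\dim y).+1 - q ^ \dim y)%N)
  => [|x]; last first.
  rewrite inE => /andP[/andP[yx /eqP <-] xw]; rewrite -card_setDv //.
  apply: eq_card => v; rewrite !inE; case: (boolP (v \in x)) => vx; rewrite ?andbF //=.
  by rewrite andbT (subvP xw).
rewrite !sum_nat_const muln1 card_setDv //.
have := gauss_intE (\dim w - \dim y); have := card_field_gt1; have := dimvS yw.
move: (\dim w) (\dim y) #|S| (gauss_int _) => a b n g ab q1 gE.
rewrite -{1}(subnKC ab) expnD -[X in (_ - X)%N]muln1 -mulnBr -gE expnSr.
rewrite -[X in (_ * (_ - X))%N]muln1 -mulnBr mulnCA mulnA [RHS]mulnC => /eqP.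
rewrite [((q - 1) * _)%N]mulnC eqn_pmul2l; first by move/eqP.
by rewrite muln_gt0 subn_gt0 q1 expn_gt0 ltnW.
Qed.

(** Induction on the codimension of [s] in [w], by double counting of pairs [v \in x] with [v] in
    [w] but not in [s]: the hyperplanes of [w] above [s] that contain [v] are those above [s +
    <[v]>]. *)
Lemma card_covers_ge s w : (s <= w)%VS ->
  #|[set x | covers w x & (s <= x)%VS]| = gauss_int (\dim w - \dim s).
Proof.
have base : #|[set x | covers w x & (w <= x)%VS]| = gauss_int (\dim w - \dim w).
  rewrite /gauss_int subnn big_ord0; apply/eqP; rewrite cards_eq0 -subset0.
  apply/subsetP => x; rewrite !inE => /andP[/andP[_ /eqP dx] /dimvS].
  by rewrite dx ltnn.
move: {2}(\dim w - \dim s)%N (leqnn (\dim w - \dim s)) => n.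
elim: n s => [|n IHn] s le_n sw; set S := [set x | _ & _].
  by rewrite /S (_ : s = w) //; apply/eqP; rewrite eqEdim sw -subn_eq0 -leqn0.
(* Codimension at most 1 is treated apart: the factor [gauss_int] of the codimension minus 1,
   cancelled at the end, vanishes there. *)
have [dws|dws] := leqP (\dim w - \dim s)%N 1.
  have [ws|ws] := eqVneq s w; first by rewrite /S ws.
  have d1 : (\dim w - \dim s = 1)%N.
    apply/eqP; rewrite eqn_leq dws /= subn_gt0 ltnNge; apply: contra ws => ws.
    by rewrite eqEdim sw.
  rewrite d1 /gauss_int big_ord1 expn0; apply/eqP/cards1P; exists s.
  apply/setP => x; rewrite !inE; apply/idP/eqP => [/andP[/andP[_ /eqP dx] sx]|->].
    apply/eqP; rewrite eq_sym eqEdim sx /= -ltnS -dx.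
    by rewrite -(subnK (dimvS sw)) d1.
  by rewrite subvv andbT /covers sw -(subnK (dimvS sw)) d1 /=.
have := double_counting [set v : fH | v \in w & v \notin s] S
  (fun v x => v \in x).
rewrite (eq_bigr (fun=> gauss_int (\dim w - (\dim s).+1))) => [|v]; last first.
  rewrite inE => /andP[vw vs]; rewrite card_covers_ge_through -(dim_add_line vs).
  apply: IHn; last by rewrite sub_add_line sw.
  by rewrite dim_add_line // subnS; case: (_ - _)%N le_n.
rewrite [X in _ = X -> _](eq_bigr (fun=> q ^ (\dim w).-1 - q ^ \dim s)%N)
  => [|x]; last first.
  rewrite inE => /andP[/andP[xw /eqP ->] sx] /=; rewrite -card_setDv //.
  apply: eq_card => v; rewrite !inE; case: (boolP (v \in x)) => vx; rewrite ?andbF //=.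
  by rewrite andbT (subvP xw).
rewrite !sum_nat_const card_setDv // subnS.
have := gauss_intE (\dim w - \dim s).-1; have := gauss_intE (\dim w - \dim s).
have := card_field_gt1; have := dimvS sw.
case: (\dim w - \dim s)%N (subnK (dimvS sw)) dws => [|m] //= <- m1 _ q1.
rewrite addSn /= -addSn !expnD.
move: (\dim s) #|S| (gauss_int m.+1) (gauss_int m) => b k g1 g gE1 gE.
rewrite -[X in (X * g = _)%N -> _](_ : q ^ b * ((q - 1) * g1) = _)%N; last first.
  by rewrite gE1 mulnBr muln1 mulnC.
rewrite -[X in (_ = k * X)%N -> _](_ : q ^ b * ((q - 1) * g) = _)%N; last first.
  by rewrite gE mulnBr muln1 mulnC.
have g0 : (0 < g)%N.
  rewrite lt0n; apply: contraTneq m1 => g0; move: gE; rewrite g0 muln0.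
  by move/esym/eqP; rewrite subn_eq0 -(expn0 q) leq_exp2l // leqn0 => /eqP ->.
have -> : (k * (q ^ b * ((q - 1) * g)) = (q ^ b * ((q - 1) * k)) * g)%N.
  by rewrite mulnC -!mulnA [(g * k)%N]mulnC.
move/eqP; rewrite eqn_pmul2r // eqn_pmul2l ?expn_gt0 ?(ltnW q1) //.
by rewrite eqn_pmul2l ?subn_gt0 // => /eqP.
Qed.

End Counting.

(** * The q-adjacency operator of an interval *)

Section Interval.
Variables (F : finFieldType) (H : vectType F) (K : numFieldType).
Implicit Types (s u w x y z : {vspace H}) (G L : {vspace H} -> K).
Local Notation q := (#|F|%:R : K).

Lemma cardF_gt1 : 1 < q.
Proof. by rewrite ltr1n card_field_gt1. Qed.

Lemma cardF_neq0 : q != 0.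
Proof. by rewrite gt_eqF // (lt_trans ltr01 cardF_gt1). Qed.

Lemma cardFB1_neq0 : q - 1 != 0.
Proof. by rewrite subr_eq0 gt_eqF // cardF_gt1. Qed.

Lemma natr_gauss_int n : (gauss_int F n)%:R = (q ^+ n - 1) / (q - 1) :> K.
Proof.
apply: (canRL (mulfK cardFB1_neq0)).
have -> : q - 1 = (#|F| - 1)%:R by rewrite natrB // ltnW // card_field_gt1.
rewrite mulrC -natrM gauss_intE natrB ?natrX // expn_gt0.
by rewrite (ltnW (card_field_gt1 F)).
Qed.

(** The only candidates are [w + z] on the left and [w :&: z] on the right, and by the dimension
    formula [w + z] covers [w] exactly when [z] covers [w :&: z]. *)
Lemma card_meet_join s w z : (s <= w)%VS -> (s <= z)%VS -> ~~ (z <= w)%VS ->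
  #|[set x | covers x w & (z <= x)%VS]| =
  #|[set x | covers z x & (s <= x)%VS && (x <= w)%VS]|.
Proof.
move=> sw sz zw.
have dimE := dimv_sum_cap w z.
have le_join x : covers x w -> (z <= x)%VS -> (w + z)%VS = x.
  move=> /andP[wx /eqP dx] zx; apply/eqP; rewrite eqEdim subv_add wx zx dx /=.
  rewrite ltn_neqAle dimvS ?addvSl // andbT; apply: contra zw => /eqP dE.
  suff -> : w = (w + z)%VS by exact: addvSr.
  by apply/eqP; rewrite eqEdim addvSl dE /=.
have le_meet x : covers z x -> (x <= w)%VS -> (w :&: z)%VS = x.
  move=> /andP[xz /eqP dx] xw; apply/eqP; rewrite eq_sym eqEdim subv_cap xw xz /=.
  rewrite -ltnS -dx ltn_neqAle dimvS ?capvSr // andbT; apply: contra zw => /eqP dE.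
  suff -> : z = (w :&: z)%VS by exact: capvSl.
  by apply/esym/eqP; rewrite eqEdim capvSr dE /=.
have [dj|dj] := eqVneq (\dim (w + z)) (\dim w).+1.
  have dm : \dim z == (\dim (w :&: z)).+1.
    by move: dimE; rewrite dj addSnnS => /addnI ->.
  have -> : [set x | covers x w & (z <= x)%VS] = [set (w + z)%VS].
    apply/setP => x; rewrite !inE; apply/andP/eqP => [[cx zx]|->].
      by rewrite (le_join x).
    by rewrite /covers addvSl addvSr dj eqxx.
  have -> : [set x | [&& covers z x, (s <= x)%VS & (x <= w)%VS]] = [set (w :&: z)%VS].
    apply/setP => x; rewrite !inE; apply/and3P/eqP => [[cx _ xw]|->].
      by rewrite (le_meet x).
    by rewrite /covers capvSl capvSr dm subv_cap sw sz.
  by rewrite !cards1.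
rewrite !eq_card0 // => x; rewrite !inE; apply/negP.
  move=> /and3P[cx sx xw]; have cx' := cx; move: cx' => /andP[_ /eqP dx].
  by move: dimE dj; rewrite (le_meet x cx xw) dx addnS -addSn => /addIn ->; rewrite eqxx.
move=> /andP[cx zx]; have cx' := cx; move: cx' => /andP[_ /eqP dx].
by move: dj; rewrite (le_join x cx zx) dx eqxx.
Qed.

Lemma sumr_indicator (T : finType) (P Q : pred T) :
  \sum_(i | P i) (Q i)%:R = #|[set i | P i & Q i]|%:R :> K.
Proof.
rewrite -sum1_card natr_sum [RHS](eq_bigl (fun i => P i && Q i)) => [|i]; last by rewrite inE.
by rewrite big_mkcondr; apply: eq_bigr => i _; case: (Q i).
Qed.

(* Covers of some [w] above [s] are themselves above [s]: the second sum needs no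
   restriction. *)
Definition interval_op s G w : K :=
  \sum_(x | covers w x && (s <= x)%VS) G x +
  q ^+ \dim w * \sum_(x | covers x w) G x.

Variable sqrtq : K.
Hypothesis sqrtqE : sqrtq ^+ 2 = q.

Lemma sqrtq_neq0 : sqrtq != 0.
Proof. by have := cardF_neq0; rewrite -sqrtqE expf_eq0. Qed.

(* The power [q ^ (d / 2 - k)]. *)
Definition qhalf (d k : nat) : K := sqrtq ^+ d / q ^+ k.

Lemma qhalf_neq0 d k : qhalf d k != 0.
Proof. by rewrite mulf_neq0 ?invr_eq0 ?expf_neq0 // ?cardF_neq0 ?sqrtq_neq0. Qed.

Lemma qhalfS d k : q * qhalf d k.+1 = qhalf d k.
Proof. by rewrite /qhalf exprS invfM mulrCA mulVKf // cardF_neq0. Qed.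

Definition interval_theta (n d k : nat) : K := (qhalf d k * q ^+ n - (qhalf d k)^-1) / (q - 1).

(* The base [t] is the one for which the terms in [q ^+ \dim w] cancel in the
   diagonal coefficient. *)
Lemma interval_op_qhalf s z w : (s <= z)%VS -> (s <= w)%VS ->
  let t := qhalf (\dim s) (\dim z) in
  interval_op s (fun x => t ^+ \dim x * (z <= x)%VS%:R) w =
    interval_theta (\dim {:H}) (\dim s) (\dim z) * (t ^+ \dim w * (z <= w)%VS%:R) +
    t * \sum_(x | covers z x && (s <= x)%VS)
          qhalf (\dim s) (\dim x) ^+ \dim w * (x <= w)%VS%:R.
Proof.
move=> sz sw t; rewrite /interval_op.
have t0 : t != 0 := qhalf_neq0 _ _.
have -> : \sum_(x | covers w x && (s <= x)%VS) t ^+ \dim x * (z <= x)%VS%:R =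
  t ^+ \dim w / t * #|[set x | covers w x & (z <= x)%VS]|%:R.
  rewrite -sumr_indicator mulr_sumr big_mkcondr.
  apply: eq_bigr => x /andP[_ /eqP ->]; case: ifP => sx.
    by rewrite exprSr mulfK.
  have -> : (z <= x)%VS = false by apply: contraFF sx; exact: subv_trans.
  by rewrite mulr0.
have -> : \sum_(x | covers x w) t ^+ \dim x * (z <= x)%VS%:R =
  t ^+ (\dim w).+1 * #|[set x | covers x w & (z <= x)%VS]|%:R.
  by rewrite -sumr_indicator mulr_sumr; apply: eq_bigr => x /andP[_ /eqP ->].
(* A hyperplane [x] of [z] has base [q * t]. *)
have -> : \sum_(x | covers z x && (s <= x)%VS)
          qhalf (\dim s) (\dim x) ^+ \dim w * (x <= w)%VS%:R =
   (q * t) ^+ \dim w * #|[set x | covers z x & (s <= x)%VS && (x <= w)%VS]|%:R.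
  transitivity ((q * t) ^+ \dim w *
    \sum_(x | covers z x && (s <= x)%VS) (x <= w)%VS%:R : K).
    rewrite mulr_sumr; apply: eq_bigr => x /andP[/andP[_ /eqP dz] _].
    by rewrite /t dz qhalfS.
  rewrite sumr_indicator; congr (_ * _%:R).
  by apply: eq_card => x; rewrite !inE andbA.
have [zw|zw] := boolP (z <= w)%VS; last first.
  rewrite -(card_meet_join sw sz zw) [X in _ * X%:R + _](_ : _ = 0%N); last first.
    apply/eqP; rewrite cards_eq0 -subset0; apply/subsetP => x.
    rewrite !inE => /andP[/andP[xw _] zx]; move: zw.
    by rewrite (subv_trans zx xw).
  rewrite [(q * t) ^+ _]exprMn !mulr0 !add0r exprS -(mulrA t).
  by rewrite -(mulrA (q ^+ _)) mulrCA.
rewrite card_covers_ge //.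
have -> : #|[set x | covers x w & (z <= x)%VS]| = gauss_int F (\dim {:H} - \dim w).
  rewrite -card_covers_le ?subvf //; apply: eq_card => x; rewrite !inE subvf.
  apply: andb_id2l => /andP[wx _]; exact: subv_trans zw wx.
have -> : #|[set x | covers z x & (s <= x)%VS && (x <= w)%VS]| = gauss_int F (\dim z - \dim s).
  rewrite -card_covers_ge //; apply: eq_card => x; rewrite !inE.
  by apply: andb_id2l => /andP[xz _]; rewrite (subv_trans xz zw) andbT.
rewrite !natr_gauss_int /interval_theta -/t mulr1 [(q * t) ^+ _]exprMn [t ^+ _.+1]exprSr.
have := dimvS sz; have := dimvS zw; have := dimvS (subvf w).
move: (t ^+ \dim w) => tw; rewrite {t0}/t /qhalf.
move: (\dim {:H}) (\dim w) (\dim z) (\dim s) => n j k d jn kj dk.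
rewrite !expfB_cond ?(negPf cardF_neq0) //.
have sd : sqrtq ^+ d * sqrtq ^+ d = q ^+ d by rewrite -sqrtqE -exprM mulnC exprM expr2 -exprMn -expr2.
rewrite -sd.
have := cardFB1_neq0; have q0 := cardF_neq0; have s0 := sqrtq_neq0.
have := expf_neq0 d s0; have := expf_neq0 k q0; have := expf_neq0 j q0.
move: (sqrtq ^+ d) (q ^+ k) (q ^+ j) (q ^+ n) (q - 1) => S Q J N q1 J0 Q0 S0 q10.
field.
by rewrite S0 Q0 J0 q10.
Qed.

(** [L] is a left eigenvector. It is paired, as [T z], with the functions of [interval_op_qhalf]; at
    a [z] of minimal dimension with [T z != 0] the hyperplane terms vanish and only the diagonal
    coefficient remains. *)
Lemma interval_op_eigenvalue s L a :
    (forall w, ~~ (s <= w)%VS -> L w = 0) -> (exists w, L w != 0) ->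
    (forall G, \sum_w L w * interval_op s G w = a * \sum_w L w * G w) ->
  exists2 k, (\dim s <= k <= \dim {:H})%N & a = interval_theta (\dim {:H}) (\dim s) k.
Proof.
move=> L0 [w0 Lw0] La.
pose T z := \sum_w L w * (qhalf (\dim s) (\dim z) ^+ \dim w * (z <= w)%VS%:R).
have [z0 /andP[sz0 Tz0]] : exists z, (s <= z)%VS && (T z != 0).
  (* At a [w] of maximal dimension in the support of [L], the sum [T w] reduces to its term at
     [w]. *)
  have [w Lw wmax] := @arg_maxnP _ w0 (fun w => L w != 0) (fun w => \dim w) Lw0.
  exists w; apply/andP; split; first by apply: contraNT Lw => /L0 ->.
  rewrite /T (bigD1 w) //= big1 => [|x xw].
    by rewrite subvv mulr1 addr0 mulf_neq0 // expf_neq0 // qhalf_neq0.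
  have [wx|_] := boolP (w <= x)%VS; last by rewrite !mulr0.
  rewrite [L x](_ : _ = 0) ?mul0r //; apply: contraNeq xw => /wmax dx.
  by rewrite eq_sym eqEdim wx.
have [z /andP[sz Tz] zmin] := @arg_minnP _ z0
  (fun z => (s <= z)%VS && (T z != 0)) (fun z => \dim z) (introT andP (conj sz0 Tz0)).
exists (\dim z); first by rewrite !dimvS ?subvf.
apply: (mulIf Tz); rewrite -La.
transitivity (\sum_w (interval_theta (\dim {:H}) (\dim s) (\dim z) *
    (L w * (qhalf (\dim s) (\dim z) ^+ \dim w * (z <= w)%VS%:R)) +
  qhalf (\dim s) (\dim z) * \sum_(x | covers z x && (s <= x)%VS)
     L w * (qhalf (\dim s) (\dim x) ^+ \dim w * (x <= w)%VS%:R))).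
  apply: eq_bigr => w _; have [sw|sw] := boolP (s <= w)%VS; last first.
    rewrite L0 // !mul0r mulr0 add0r big1 ?mulr0 // => x _; exact: mul0r.
  by rewrite interval_op_qhalf // mulrDr -mulr_sumr !(mulrCA (L w)).
rewrite big_split /= -!mulr_sumr exchange_big /= [X in _ + _ * X]big1 ?mulr0 ?addr0 //.
move=> x /andP[/andP[_ /eqP dz] sx]; apply/eqP/negPn/negP => Tx.
have := zmin x; rewrite sx; move/(_ Tx); by rewrite dz ltnn.
Qed.

End Interval.

(** * The q-adjacency operator of the attenuated space *)

Section AttOperator.
Variables (F : finFieldType) (H : vectType F) (h : {vspace H}) (K : numFieldType).
Implicit Types (s u w x y z : {vspace H}) (f G L : {vspace H} -> K).
Local Notation q := (#|F|%:R : K).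
Local Notation att := (att_space h).

Lemma dim_att_add y : y \in att -> \dim (y + h) = (\dim y + \dim h)%N.
Proof. by rewrite inE => /eqP; apply: dimv_disjoint_sum. Qed.

Lemma att_dimP y : (y \in att) = (\dim (y + h) == \dim y + \dim h)%N.
Proof.
by rewrite inE -dimv_sum_cap -dimv_eq0 -{1}[\dim (y + h)]addn0 eqn_add2l eq_sym.
Qed.

Lemma att_sub x y : (x <= y)%VS -> y \in att -> x \in att.
Proof. by rewrite !inE -!subv0 => xy; apply: subv_trans; exact: capvS. Qed.

Definition att_op f y : K :=
  \sum_(x in att | covers y x) f x + q ^+ \dim y * \sum_(x in att | covers x y) f x.

Lemma capv_addh w y : y \in att -> (h <= w)%VS -> (w <= y + h)%VS ->
  (w :&: y + h)%VS = w.
Proof.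
by move=> yX hw wy; rewrite vspace_modr // (capv_idPl _).
Qed.

Lemma addh_capv x y : y \in att -> (x <= y)%VS -> ((x + h) :&: y)%VS = x.
Proof.
by rewrite inE capvC => /eqP yh xy; rewrite -vspace_modl // yh addv0.
Qed.

(* Modular law: [x |-> x + h] identifies the interval [0, y] with [h, y + h]. *)
Lemma sum_covered_by u y G : u \in att -> y \in att -> (u <= y)%VS ->
  \sum_(x in att | covers y x) (u <= x)%VS%:R * G (x + h)%VS =
  \sum_(w | covers (y + h)%VS w && (u + h <= w)%VS) G w.
Proof.
move=> uX yX uy.
under eq_bigr do rewrite mulr_natl mulrb.
rewrite -big_mkcondr /=.
rewrite (reindex_onto (fun w => w :&: y)%VS (fun x => x + h)%VS) /=; last first.
  by move=> x /andP[/andP[_ /andP[xy _]] _]; exact: addh_capv.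
apply: eq_big => [w|w]; last first.
  by move=> /andP[_ /eqP ->].
apply/idP/idP => [|/andP[/andP[wy /eqP dw]]].
  move=> /andP[/andP[/andP[wX /andP[wy /eqP dw]] uw] /eqP wE].
  rewrite -wE /covers !addvS // ?dim_att_add // dw addSn eqxx andbT //=.
rewrite subv_add => /andP[uw hw]; have wE := capv_addh yX hw wy.
have wX : (w :&: y)%VS \in att := att_sub (capvSr _ _) yX.
rewrite wE eqxx wX /covers capvSr subv_cap uw uy !andbT /=.
by rewrite -(eqn_add2r (\dim h)) -dim_att_add // dw addSn -dim_att_add // wE.
Qed.

(** These are the covers of [y] inside [w] that do not lie in [y + h]; the count is a difference of
    two consecutive values of [gauss_int]. *)
Lemma card_att_covers y w : y \in att -> covers w (y + h)%VS ->
  #|[set x in att | covers x y & (x + h)%VS == w]| = (#|F| ^ \dim h)%N.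
Proof.
move=> yX /andP[yw /eqP dw].
have -> : [set x in att | covers x y & (x + h)%VS == w] =
  [set x | covers x y & (x <= w)%VS] :\: [set x | covers x y & (x <= y + h)%VS].
  apply/setP => x; rewrite !inE.
  case: (boolP (covers x y)) => [cx|]; rewrite ?andbF //=.
  have cx' := cx; move: cx' => /andP[yx /eqP dx].
  apply/andP/andP => [[xX /eqP <-]|[xy xw]].
    rewrite addvSl; split=> //; apply/negP => xy.
    have /dimvS : (x + h <= y + h)%VS by rewrite subv_add xy addvSr.
    by rewrite !dim_att_add // ?dx ?addSn ?ltnn // inE.
  have hw : (h <= w)%VS by apply: subv_trans yw; exact: addvSr.
  have xhw : (x + h)%VS == w.
    rewrite eqEdim subv_add xw hw dw /= ltn_neqAle dimvS ?addvS // andbT.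
    apply: contra xy => /eqP dE.
    suff -> : (y + h = x + h)%VS by exact: addvSl.
    by apply/eqP; rewrite eqEdim addvS // dE /=.
  split=> //; have := att_dimP x; rewrite inE => ->.
  by rewrite (eqP xhw) dw dim_att_add // dx addSn.
rewrite cardsDS; last first.
  apply/subsetP => x; rewrite !inE => /andP[-> xy] /=; exact: subv_trans yw.
rewrite !card_covers_le ?addvSl ?(subv_trans (addvSl y h)) //.
rewrite dw dim_att_add // subSn ?leq_addr // addKn.
by rewrite /gauss_int big_ord_recr /= addKn.
Qed.

Lemma sum_covering u y G : u \in att -> y \in att -> (u <= y)%VS ->
  \sum_(x in att | covers x y) (u <= x)%VS%:R * G (x + h)%VS =
  q ^+ \dim h * \sum_(w | covers w (y + h)%VS) G w.
Proof.
move=> uX yX uy.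
rewrite (partition_big (fun x => x + h)%VS (fun w => covers w (y + h)%VS)) /=.
  rewrite mulr_sumr; apply: eq_bigr => w cw.
  rewrite (eq_bigr (fun=> G w)) => [|x]; last first.
    move=> /andP[/andP[_ /andP[yx _]] /eqP <-].
    by rewrite (subv_trans uy yx) mul1r.
  rewrite sumr_const -natrX -(card_att_covers yX cw) mulr_natl; congr (_ *+ _).
  by apply: eq_card => x; rewrite [RHS]inE andbA.
move=> x /andP[xX /andP[yx /eqP dx]].
by rewrite /covers addvS // !dim_att_add // dx addSn /=.
Qed.

(* When [y] is not above [u], only [y + u] can be a cover of [y] above [u], and
   then [y] is above exactly one hyperplane of [u]. *)
Lemma sum_covering_out u y G : u \in att -> y \in att -> ~~ (u <= y)%VS ->
  \sum_(x in att | covers x y) (u <= x)%VS%:R * G (x + h)%VS =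
  \sum_(v | covers u v) (v <= y)%VS%:R * ((~~ (u <= y + h)%VS)%:R * G (y + h + u)%VS).
Proof.
move=> uX yX uy.
have dimE := dimv_sum_cap y u.
have coverE : covers (y + u) y = covers u (y :&: u).
  by rewrite /covers addvSl capvSr /= -(eqn_add2r (\dim (y :&: u))) dimE addSnnS eqn_add2l.
rewrite [LHS](_ : _ = if ((y + u)%VS \in att) && covers (y + u) y
                      then G (y + u + h)%VS else 0); last first.
  rewrite [RHS](_ : _ = \sum_(x in att | covers x y)
       (if x == (y + u)%VS then G (x + h)%VS else 0)).
    apply: eq_bigr => x /andP[xX /andP[yx /eqP dx]].
    rewrite eq_sym eqEdim subv_add yx dx /= ltn_neqAle [(\dim y <= _)%N]dimvS ?addvSl //.
    rewrite andbT; case: (u <= x)%VS; rewrite ?mul1r ?mul0r //=.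
    case: eqP => // dE; move: uy; rewrite [y](_ : y = y + u)%VS ?addvSr //.
    by apply/eqP; rewrite eqEdim addvSl dE /=.
  rewrite -big_mkcondr /=; case: ifP => cxu.
    by rewrite (big_pred1 (y + u)%VS) // => x /=; case: eqP => [->|]; rewrite ?andbF ?cxu.
  by rewrite big_pred0 // => x; case: eqP => [->|]; rewrite ?andbF ?cxu.
rewrite [RHS](_ : _ = if covers u (y :&: u)
   then (~~ (u <= y + h)%VS)%:R * G (y + h + u)%VS else 0); last first.
  rewrite [LHS](_ : _ = \sum_(v | covers u v)
      (if v == (y :&: u)%VS then ((~~ (u <= y + h)%VS)%:R * G (y + h + u)%VS) else 0)).
    rewrite -big_mkcondr /=; case: ifP => cxu.
      by rewrite (big_pred1 (y :&: u)%VS) // => x /=; case: eqP => [->|]; rewrite ?andbF ?cxu.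
    by rewrite big_pred0 // => x; case: eqP => [->|]; rewrite ?andbF ?cxu.
  apply: eq_bigr => v /andP[vu /eqP du].
  rewrite eqEdim subv_cap vu andbT -ltnS -du ltn_neqAle [(_ <= \dim u)%N]dimvS ?capvSr // andbT.
  case: (v <= y)%VS; rewrite ?mul1r ?mul0r //=.
  case: eqP => // dE; move: uy; rewrite [u](_ : u = y :&: u)%VS ?capvSl //.
  by apply/esym/eqP; rewrite eqEdim capvSr dE /=.
(* What remains is that, for [y + u] covering [y], membership of [y + u] in [att] is equivalent to
   [u] not lying in [y + h]. *)
rewrite coverE andbC; case: (boolP (covers u _)) => //= cu.
case: ifP => [yuX|/negbT yuX].
  rewrite (_ : (u <= y + h)%VS = false) /= ?mul1r -?addvA ?(addvC u) //.
  apply: contraNF uy => uyh.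
  by rewrite -[y](addh_capv yuX (addvSl y u)) subv_cap uyh addvSr.
rewrite (_ : (u <= y + h)%VS) ?mul0r //; apply: contraR yuX => uyh.
have /andP[_ /eqP du] := cu.
have capE : ((y + h) :&: u = y :&: u)%VS.
  apply/eqP; rewrite eq_sym eqEdim capvS ?addvSl //= -ltnS -du.
  rewrite ltn_neqAle [(_ <= \dim u)%N]dimvS ?capvSr // andbT.
  apply: contra uyh => /eqP dE; suff <- : ((y + h) :&: u = u)%VS by exact: capvSl.
  by apply/eqP; rewrite eqEdim capvSr dE /=.
rewrite att_dimP -addvA (addvC u) addvA -(eqn_add2r (\dim ((y + h) :&: u))) dimv_sum_cap capE.
by rewrite dim_att_add // [eqbRHS]addnAC dimE addnAC.
Qed.

(** For [u <= y], the weights [q ^+ \dim y] and [q ^+ \dim h] (the fibre size of [sum_covering])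
    multiply to [q ^+ \dim (y + h)], the weight in [interval_op]. *)
Lemma att_op_above u y G : u \in att -> y \in att ->
  att_op (fun x => (u <= x)%VS%:R * G (x + h)%VS) y =
  (u <= y)%VS%:R * interval_op (u + h)%VS G (y + h)%VS +
  q ^+ \dim y * \sum_(v | covers u v)
     (v <= y)%VS%:R * ((~~ (u <= y + h)%VS)%:R * G (y + h + u)%VS).
Proof.
move=> uX yX; rewrite /att_op /interval_op.
have [uy|uy] := boolP (u <= y)%VS.
  rewrite sum_covered_by // sum_covering // dim_att_add // exprD mul1r mulrA.
  rewrite [\sum_(v | covers u v) _]big1 ?mulr0 ?addr0 // => v _.
  by rewrite (subv_trans uy (addvSl _ _)) mul0r mulr0.
rewrite sum_covering_out // mul0r big1 // => x /andP[_ /andP[xy _]].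
have -> : (u <= x)%VS = false by apply: contraNF uy => ux; exact: subv_trans ux xy.
by rewrite mul0r.
Qed.

Variable sqrtq : K.
Hypothesis sqrtqE : sqrtq ^+ 2 = q.
Local Notation interval_theta := (@interval_theta F K sqrtq).
Local Notation qhalf := (@qhalf F K sqrtq).

(** For [u] of minimal dimension with [E u] nonzero, [E v] vanishes for every hyperplane [v] of [u].
    The extra terms of [att_op_above] thus disappear, and [E u] is a left eigenvector of the
    operator of [[u + h, H]]. *)
Lemma att_op_eigenvalue (l : {vspace H} -> K) a :
    (exists2 y, y \in att & l y != 0) ->
    (forall f, \sum_(y in att) l y * att_op f y = a * \sum_(y in att) l y * f y) ->
  exists r k, (r + \dim h <= k <= \dim {:H})%N /\ a = interval_theta (\dim {:H}) (r + \dim h) k.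
Proof.
move=> [y0 y0X ly0] la.
pose E u w := \sum_(y in att | (u <= y)%VS && ((y + h)%VS == w)) l y.
have sumE u G : \sum_(y in att) l y * ((u <= y)%VS%:R * G (y + h)%VS) =
    \sum_w E u w * G w.
  rewrite (partition_big (fun y => y + h)%VS xpredT) //=; apply: eq_bigr => w _.
  rewrite /E mulr_suml big_mkcond [RHS]big_mkcond; apply: eq_bigr => y _ /=.
  case: (y \in att) => //=; case: eqP => [->|]; rewrite ?andbF // andbT.
  by case: ifP; rewrite ?mul1r // mul0r mulr0.
have [|u /andP[uX /existsP[w0 Lw0]] umin] :=
  @arg_minnP _ y0 (fun u => (u \in att) && [exists w, E u w != 0]) (fun u => \dim u).
- rewrite y0X; apply/existsP; exists (y0 + h)%VS.
  rewrite /E (big_pred1 y0) // => y /=; apply/andP/eqP => [[yX /andP[y0y /eqP yE]]|->].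
    apply/eqP; rewrite eq_sym eqEdim y0y -(leq_add2r (\dim h)).
    by rewrite -!dim_att_add ?yE ?leqnn.
  by rewrite subvv eqxx.
have E0 v w : covers u v -> E v w = 0.
  move=> /andP[vu /eqP du]; apply/eqP; apply: contraT => Evw.
  have := umin v; rewrite (att_sub vu uX) du ltnn; apply.
  by apply/existsP; exists w.
have [w uhw||G|k dk ->] := @interval_op_eigenvalue F H K sqrtq sqrtqE (u + h)%VS (E u) a.
- rewrite /E big1 // => y /andP[yX /andP[uy /eqP yE]].
  by move: uhw; rewrite -yE addvS.
- by exists w0.
- rewrite -!sumE -la; apply/esym.
  (* Writing [q ^+ \dim y] as [q ^+ \dim (y + h) / q ^+ \dim h] makes the extra terms functions of
     [y + h], to which [sumE] applies. *)
  transitivity (\sum_(y in att) (l y * ((u <= y)%VS%:R * interval_op (u + h)%VS G (y + h)%VS) +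
    \sum_(v | covers u v) l y * ((v <= y)%VS%:R *
     (q ^+ \dim (y + h) / q ^+ \dim h * ((~~ (u <= y + h)%VS)%:R * G (y + h + u)%VS))))).
    apply: eq_bigr => y yX; rewrite att_op_above // mulrDr !mulr_sumr; congr (_ + _).
    apply: eq_bigr => v _; rewrite dim_att_add // exprD mulfK ?expf_neq0 ?cardF_neq0 //.
    by rewrite (mulrCA (q ^+ _)).
  rewrite big_split /= [X in _ + X]exchange_big /= [X in _ + X]big1 ?addr0 // => v cuv.
  rewrite (sumE v (fun w => q ^+ \dim w / q ^+ \dim h * ((~~ (u <= w)%VS)%:R * G (w + u)%VS))).
  by rewrite big1 // => w _; rewrite E0 ?mul0r.
by exists (\dim u), k; rewrite -dim_att_add.
Qed.

Lemma interval_op_dim s w (a : nat -> K) : (s <= w)%VS ->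
  interval_op s (fun x => a (\dim x)) w =
  (gauss_int F (\dim w - \dim s))%:R * a (\dim w).-1 +
  q ^+ \dim w * ((gauss_int F (\dim {:H} - \dim w))%:R * a (\dim w).+1).
Proof.
move=> sw; rewrite /interval_op -card_covers_ge // -(card_covers_le (subvf w)).
congr (_ + _ * _).
  rewrite mulr_natl -sumr_const; apply: eq_big => [x|x]; first by rewrite inE.
  by move=> /andP[/andP[_ /eqP ->] _].
rewrite mulr_natl -sumr_const; apply: eq_big => [x|x]; first by rewrite inE subvf andbT.
by move=> /andP[_ /eqP ->].
Qed.

(* At [j = d] the first coefficient vanishes, so that [a d.-1] is irrelevant. *)
Definition tridiag (n d : nat) (a : nat -> K) (j : nat) : K :=
  (gauss_int F (j - d))%:R * a j.-1 + q ^+ j * ((gauss_int F (n - j))%:R * a j.+1).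

(* Up to a scalar, the sum over the [z] of dimension [d + m] of the functions of
   [interval_op_qhalf], with [j = \dim w]: the product is, up to a scalar, the
   number of such [z] below [w]. *)
Definition bidiag_basis (d m j : nat) : K :=
  qhalf d (d + m) ^+ j * \prod_(l < m) (q ^+ j - q ^+ (d + l)).

(** The off-diagonal entry from index [m.+1] to index [m] of [tridiag] in the family
    [bidiag_basis]. *)
Definition bidiag_coef (n d m : nat) : K :=
  qhalf d (d + m.+1) * (q * q ^+ m) * (q ^+ n - q ^+ (d + m)) * (1 - (q * q ^+ m)^-1) / (q - 1).

(** In the variable [x = q ^+ j], raising [j] by 1 is scaling [x] by [q]; [downE] and [upE] compare
    the product at [x] and at [q * x] by telescoping its factors. The rest is an identity of
    rational functions modulo [t2]. *)
Lemma bidiag_basisE n d m j : (0 < d)%N -> (d <= j <= n)%N ->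
  tridiag n d (bidiag_basis d m) j = interval_theta n d (d + m) * bidiag_basis d m j +
    (if m is m'.+1 then bidiag_coef n d m' * bidiag_basis d m' j else 0).
Proof.
move=> d0 /andP[dj jn].
pose P m (x : K) := \prod_(l < m) (x - q ^+ (d + l)).
have q0 : q != 0 := cardF_neq0 F K.
have q10 : q - 1 != 0 := cardFB1_neq0 F K.
have PS (i : nat) (x : K) : P i.+1 x = P i x * (x - q ^+ (d + i)).
  by rewrite /P big_ord_recr.
have downE (i : nat) (x : K) : (q * x - q ^+ d) * P i x * q ^+ i = (q * x - q ^+ (d + i)) * P i (q * x).
  rewrite /P; elim: i => [|i IHi]; first by rewrite !big_ord0 addn0 expr0 !mulr1.
  rewrite !big_ord_recr /=.
  have -> : (q * x - q ^+ d) * (\prod_(l < i) (x - q ^+ (d + l)) * (x - q ^+ (d + i))) * q ^+ i.+1 =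
    ((q * x - q ^+ d) * (\prod_(l < i) (x - q ^+ (d + l))) * q ^+ i) * (q * x - q * q ^+ (d + i)).
    by rewrite exprS; ring.
  by rewrite IHi -exprS -addnS; ring.
have upE (i : nat) (x : K) : P i.+1 (q * x) = q ^+ i * (q * x - q ^+ d) * P i x.
  rewrite /P; elim: i => [|i IHi]; first by rewrite big_ord1 big_ord0 addn0 expr0 mul1r mulr1.
  rewrite [LHS]big_ord_recr [in RHS]big_ord_recr /= IHi addnS !exprS; ring.
have t0 := qhalf_neq0 sqrtqE d (d + m).
have t2 : qhalf d (d + m) ^+ 2 * q ^+ (d + m) * q ^+ m = 1.
  rewrite /qhalf expr_div_n -exprM mulnC exprM sqrtqE exprD.
  have := expf_neq0 d q0; have := expf_neq0 m q0.
  move: (q ^+ d) (q ^+ m) => D M M0 D0; field; by rewrite D0 M0.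
rewrite /tridiag !natr_gauss_int /bidiag_basis -!/(P _ _) /interval_theta.
rewrite !expfB_cond ?(negPf q0) //.
(* Positivity of [d] excludes [j = 0], where the predecessor would be a default value. *)
case: j dj jn => [|j] dj jn; first by have := leq_trans d0 dj.
rewrite [j.+1.-1]/=; have {}downE := downE m (q ^+ j).
have j0 := expf_neq0 j q0; have D0 := expf_neq0 d q0; have M0 := expf_neq0 m q0.
have -> : (q ^+ j.+1 / q ^+ d - 1) / (q - 1) * (qhalf d (d + m) ^+ j * P m (q ^+ j)) =
    qhalf d (d + m) ^+ j / q ^+ d / q ^+ m / (q - 1) * ((q * q ^+ j - q ^+ d) * P m (q ^+ j) * q ^+ m).
  by rewrite exprS; field; rewrite D0 M0 q10.
rewrite {}downE.
case: m t0 t2 M0 => [|m] t0 t2 M0.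
  rewrite /P !big_ord0 addr0 addn0 in t0 t2 *.
  move: (qhalf d d) t0 t2 => t t0; rewrite expr0 mulr1 => t2.
  have {D0}-> : q ^+ d = (t ^+ 2)^-1 by apply/esym/mulr1_eq.
  rewrite !exprS; move: (q ^+ j) (t ^+ j) (q ^+ n) j0 => y T N y0.
  by field; rewrite t0 q0 y0 q10.
have qhalfE : qhalf d (d + m) = q * qhalf d (d + m.+1) by rewrite addnS qhalfS.
rewrite /bidiag_coef qhalfE [(q * _) ^+ _]exprMn -[\prod_(l < m) _]/(P m (q ^+ j.+1)).
rewrite !(exprS q) [P m.+1 (q * (q * _))]upE !PS.
move: (qhalf d (d + m.+1)) t0 t2 => t t0; rewrite !exprD !(exprS q) => t2.
have M1 := expf_neq0 m q0.
rewrite !(exprS q) !(exprS t) in M0 *.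
have {D0}-> : q ^+ d = (t ^+ 2 * (q * q ^+ m) * (q * q ^+ m))^-1.
  apply/esym/mulr1_eq; rewrite -[RHS]t2; ring.
move: (q ^+ j) (t ^+ j) (q ^+ n) (q ^+ m) (P _ _) j0 M1 => y T N M W y0 M1.
field.
by rewrite t0 q0 y0 q10 M1.
Qed.

Lemma bidiag_coef_neq0 n d m : (d + m < n)%N -> bidiag_coef n d m != 0.
Proof.
move=> mn; have q1 := cardF_gt1 F K; have q0 := cardF_neq0 F K.
rewrite /bidiag_coef -exprS !mulf_neq0 ?invr_eq0 ?expf_neq0 ?cardFB1_neq0 ?(sqrtq_neq0 sqrtqE) //.
  by rewrite subr_eq0 gt_eqF // ltr_eXn2l.
by rewrite subr_eq0 eq_sym invr_eq1 gt_eqF // exprn_egt1.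
Qed.

Lemma tridiag_sum n d m (c : nat -> K) (p : nat -> nat -> K) j :
  tridiag n d (fun j => \sum_(i < m) c i * p i j) j =
  \sum_(i < m) c i * tridiag n d (p i) j.
Proof.
rewrite /tridiag !mulr_sumr -big_split; apply: eq_bigr => i _ /=.
rewrite mulrDr; congr (_ + _); first exact: mulrCA.
by rewrite !(mulrCA (c i)).
Qed.

(** The coefficients solve [c i.+1 * bidiag_coef n d i = c i * (th m - th i)]. The recursion stops
    at [i = m], so a finite combination of [bidiag_basis] is an eigenvector. *)
Lemma tridiag_eigenvector n d m : (0 < d)%N -> (d + m <= n)%N ->
  exists2 a : nat -> K, a d != 0 &
    forall j, (d <= j <= n)%N -> tridiag n d a j = interval_theta n d (d + m) * a j.
Proof.
move=> d0 mn.
pose th i := interval_theta n d (d + i).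
pose c i := \prod_(l < i) ((th m - th l) / bidiag_coef n d l).
exists (fun j => \sum_(i < m.+1) c i * bidiag_basis d i j).
  (* At [j = d] every basis function of positive index has the zero factor [q ^+ d - q ^+ d]. *)
  rewrite big_ord_recl [c _]big_ord0 mul1r big1 ?addr0 => [|i _].
    by rewrite /bidiag_basis big_ord0 mulr1 expf_neq0 // qhalf_neq0.
  by rewrite lift0 /bidiag_basis [X in _ * (_ * X)]big_ord_recl /= addn0 subrr mul0r !mulr0.
move=> j dj; rewrite tridiag_sum.
suff partial i : (i <= m)%N ->
    \sum_(k < i.+1) c k * tridiag n d (bidiag_basis d k) j =
    th m * (\sum_(k < i.+1) c k * bidiag_basis d k j) -
    (th m - th i) * c i * bidiag_basis d i j.
  by rewrite partial // subrr !mul0r subr0.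
elim: i => [_|i IHi im]; rewrite ?big_ord1 ?[LHS]big_ord_recr.
  rewrite bidiag_basisE // addr0 -/(th 0%N); ring.
rewrite [in RHS]big_ord_recr /= IHi ?(ltnW im) // bidiag_basisE // -/(th _).
have cS : c i.+1 * bidiag_coef n d i = c i * (th m - th i).
  rewrite /c big_ord_recr /= -mulrA divfK // bidiag_coef_neq0 //.
  by apply: leq_trans mn; rewrite ltn_add2l.
rewrite mulrDr mulrDr (mulrA _ (bidiag_coef _ _ _)) cS; ring.
Qed.

(** [G] is chosen before [u], so that distinct [u] with the same [u + h] share it; the half-integer
    case compares two of them. *)
Lemma att_op_above_eigen s k : (0 < \dim s)%N -> (\dim s <= k <= \dim {:H})%N ->
  exists2 G : {vspace H} -> K, G s != 0 &
    forall u y, u \in att -> y \in att -> (u + h = s)%VS ->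
     att_op (fun x => (u <= x)%VS%:R * G (x + h)%VS) y =
     interval_theta (\dim {:H}) (\dim s) k * ((u <= y)%VS%:R * G (y + h)%VS) +
     q ^+ \dim y * \sum_(v | covers u v)
       (v <= y)%VS%:R * ((~~ (u <= y + h)%VS)%:R * G (y + h + u)%VS).
Proof.
move=> d0 /andP[dk kn].
have [|a ad aE] := @tridiag_eigenvector (\dim {:H}) (\dim s) (k - \dim s) d0.
  by rewrite subnKC.
exists (fun w => a (\dim w)) => // u y uX yX us; rewrite (att_op_above (fun w => a (\dim w))) // us; congr (_ + _).
have [uy|] := boolP (u <= y)%VS; last by rewrite !mul0r mulr0.
have sy : (s <= y + h)%VS by rewrite -us addvS.
rewrite !mul1r interval_op_dim // -/(tridiag _ _ _ _) aE ?subnKC //.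
by rewrite !dimvS ?subvf.
Qed.

Lemma att_op_eigenvector_int k : (0 < \dim h <= k)%N -> (k <= \dim {:H})%N ->
  exists2 f : {vspace H} -> K, exists2 y, y \in att & f y != 0 &
    forall y, y \in att -> att_op f y = interval_theta (\dim {:H}) (\dim h) k * f y.
Proof.
move=> /andP[h0 hk] kn; have oX : 0%VS \in att by rewrite inE cap0v.
have [|G G0 GE] := @att_op_above_eigen h k h0; first by rewrite hk.
exists (fun x => (0 <= x)%VS%:R * G (x + h)%VS).
  by exists 0%VS; rewrite // sub0v mul1r add0v.
move=> y yX; rewrite GE ?add0v // big_pred0 ?mulr0 ?addr0 // => v.
by rewrite /covers dimv0 andbF.
Qed.

Lemma covers_dim1 u v : \dim u = 1%N -> covers u v = (v == 0%VS).
Proof.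
move=> u1; rewrite /covers u1 eqSS eq_sym dimv_eq0.
by case: eqP => [->|]; rewrite ?sub0v ?andbF.
Qed.

(** The only hyperplane of a line [u] is 0, so its extra term depends on [u] through [u + h] alone.
    It cancels between the lines of [v] and [v + w], where [v] is outside [h] and [w] is nonzero in
    [h]. *)
Lemma att_op_eigenvector_half k : (0 < \dim h < k)%N -> (k <= \dim {:H})%N ->
  exists2 f : {vspace H} -> K, exists2 y, y \in att & f y != 0 &
    forall y, y \in att -> att_op f y = interval_theta (\dim {:H}) (\dim h).+1 k * f y.
Proof.
move=> /andP[h0 hk] kn.
have [v _ vh] : exists2 v, v \in {:H}%VS & v \notin h.
  by apply/subvPn; apply: contraTN hk => /dimvS; rewrite -leqNgt; exact: leq_trans.
have [w wh w0] : exists2 w, w \in h & w != 0.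
  exists (vpick h); first exact: memv_pick.
  by rewrite vpick0 -dimv_eq0 -lt0n.
have lineX (e : H) : e \notin h -> (<[e]>%VS \in att) && (\dim <[e]> == 1%N).
  move=> eh; have e0 : e != 0 by apply: contraNneq eh => ->; exact: mem0v.
  by rewrite att_dimP dim_vline e0 addnC addn1 addvC dim_add_line // !eqxx.
have vwh : v + w \notin h by rewrite rpredDr.
set u1 := <[v]>%VS; set u2 := <[v + w]>%VS.
have /andP[u1X /eqP d1] : (u1 \in att) && (\dim u1 == 1%N) := lineX _ vh.
have /andP[u2X /eqP d2] : (u2 \in att) && (\dim u2 == 1%N) := lineX _ vwh.
have u12 : (u1 + h = u2 + h)%VS.
  apply/eqP; rewrite eqEdim !dim_att_add // d1 d2 leqnn andbT.
  rewrite subv_add addvSr andbT -memvE -[v](addrK w).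
  by rewrite memv_add ?memv_line // memvN.
have u21 : (u2 <= u1)%VS = false.
  apply/negP => u21; have := u21; rewrite -memvE => vw1.
  have : w \in (u1 :&: h)%VS.
    by rewrite memv_cap wh andbT -[w](addKr v) addrC memvB ?memv_line.
  by move: u1X; rewrite inE => /eqP ->; rewrite memv0 (negPf w0).
have d1h : \dim (u1 + h) = (\dim h).+1 by rewrite dim_att_add // d1.
have [||G G0] := @att_op_above_eigen (u1 + h)%VS k; rewrite ?d1h ?hk // => GE.
pose f u x : K := (u <= x)%VS%:R * G (x + h)%VS.
exists (fun x => f u1 x - f u2 x).
  by exists u1; rewrite // /f subvv u21 mul1r mul0r subr0.
move=> y yX.
have -> : att_op (fun x => f u1 x - f u2 x) y = att_op (f u1) y - att_op (f u2) y.
  by rewrite /att_op !sumrB mulrBr opprD addrACA.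
rewrite /f !GE // mulrBr opprD addrACA -[RHS]addr0; congr (_ + _).
rewrite (eq_bigl _ _ (fun v => covers_dim1 v d1)) (eq_bigl _ _ (fun v => covers_dim1 v d2)).
rewrite !big_pred1_eq !sub0v !mul1r.
have uyh u : (u <= y + h)%VS = (u + h <= y + h)%VS by rewrite subv_add addvSr andbT.
by rewrite (uyh u1) (uyh u2) u12 -!addvA ![(h + _)%VS]addvC u12 subrr.
Qed.

End AttOperator.

(** * The q-adjacency matrix *)

(** Conjugation by the diagonal matrix of [c] gives a real symmetric, hence normal, matrix, to which
    the spectral theorem applies. *)
Lemma symmetrizable_diagonalizable (C : numClosedFieldType) n (A : 'M[C]_n) (c : 'I_n -> C) :
    (forall i, c i != 0) ->
    (forall i j, c i * A i j / c j \is Num.real) ->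
    (forall i j, c i * A i j / c j = c j * A j i / c i) ->
  diagonalizable A.
Proof.
move=> c0 realB symB.
pose D := diag_mx (\row_i c i); pose B := \matrix_(i, j) (c i * A i j / c j).
have BE : D *m A = B *m D.
  by apply/matrixP => i j; rewrite mul_diag_mx mul_mx_diag !mxE divfK.
have Bnormal : B \is normalmx.
  apply: symmetric_normalmx; last by apply/mxOverP => i j; rewrite mxE.
  apply/is_hermitianmxP; rewrite expr0 scale1r map_mx_id //.
  by apply/matrixP => i j; rewrite !mxE symB.
have Pu : spectralmx B \in unitmx := spectral_unit B.
have Du : D \in unitmx.
  by rewrite unitmxE det_diag unitfE; apply/prodf_neq0 => i _; rewrite mxE.
exists (spectralmx B *m D); first by rewrite unitmx_mul Pu.
apply/diagonalizable_forPex; exists (spectral_diag B).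
apply/simmxP; first by rewrite unitmx_mul Pu.
by rewrite -mulmxA BE {2}(orthomx_spectralP Bnormal) !mulmxA mulmxV // mul1mx.
Qed.

Section Matrix.
Variables (F : finFieldType) (H : vectType F) (h : {vspace H}) (R : realType).
Local Notation att := (att_space h).
Local Notation A := (q_adjacency h R).
Local Notation C := (R[i]).

Lemma covers_asym (x y : {vspace H}) : covers x y -> covers y x = false.
Proof.
move=> /andP[_ /eqP dx]; rewrite /covers dx andbC.
by rewrite [_ == _](_ : _ = false) //; apply/eqP => /esym; apply/eqP; rewrite gtn_eqF // ltnW.
Qed.

Lemma q_adjacency_sum (f : {vspace H} -> C) a :
  \sum_b A a b * f (enum_val b) = att_op h f (enum_val a).
Proof.
rewrite /att_op mulr_sumr big_mkcondr [X in _ + X]big_mkcondr /= -big_split /=.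
rewrite [RHS]big_enum_val; apply: eq_bigr => b _; rewrite mxE /=.
case: ifP => [/covers_asym ->|_]; first by rewrite mul1r addr0.
by case: ifP; rewrite add0r // mul0r.
Qed.

Variable sqrtq : C.
Hypothesis sqrtqE : sqrtq ^+ 2 = #|F|%:R.

Lemma q_adjacency_diagonalizable : sqrtq \is Num.real -> diagonalizable A.
Proof.
move=> sqrtq_real.
have s0 : sqrtq != 0 := sqrtq_neq0 sqrtqE.
(* Consecutive binomials ['C(d.+1, 2)] and ['C(d, 2)] differ by [d], so both entries of an adjacent
   pair become [sqrtq ^+ d], with [d] the smaller dimension. *)
pose c (i : 'I_#|att|) : C := sqrtq ^+ 'C(\dim (enum_val i), 2).
have BE i j : c i * A i j / c j =
    if covers (enum_val i) (enum_val j) then sqrtq ^+ \dim (enum_val j)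
    else if covers (enum_val j) (enum_val i) then sqrtq ^+ \dim (enum_val i) else 0.
  rewrite mxE /=; case: ifP => [/andP[_ /eqP di]|_].
    by rewrite /c di binS bin1 mulr1 exprD mulrAC mulfV ?expf_neq0 ?mul1r.
  case: ifP => [/andP[_ /eqP dj]|_]; last by rewrite mulr0 mul0r.
  rewrite /c dj binS bin1 exprD -sqrtqE -exprM mulnC exprM expr2.
  have := expf_neq0 'C(\dim (enum_val i), 2) s0; have := expf_neq0 (\dim (enum_val i)) s0.
  move: (sqrtq ^+ \dim _) (sqrtq ^+ 'C(_, _)) => x y x0 y0.
  by field; rewrite x0 y0.
apply: (@symmetrizable_diagonalizable _ _ _ c) => [i|i j|i j].
- by rewrite expf_neq0.
- by rewrite BE; do 2?case: ifP => _; rewrite ?realX // real0.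
- rewrite !BE; case: ifP => [/covers_asym ->//|_].
  by case: ifP => // /covers_asym ->.
Qed.

Lemma eigenvalue_tr (K : fieldType) n (B : 'M[K]_n) a : eigenvalue B^T a = eigenvalue B a.
Proof.
rewrite /eigenvalue /eigenspace !kermx_eq0 !row_free_unit.
by rewrite -[in RHS]unitmx_tr linearB /= tr_scalar_mx.
Qed.

Lemma q_adjacency_eigenvalue a :
  eigenvalue A^T a -> exists r k, (r + \dim h <= k <= \dim {:H})%N /\
     a = interval_theta F sqrtq (\dim {:H}) (r + \dim h) k.
Proof.
rewrite eigenvalue_tr => /eigenvalueP[l lA l0].
(* The sum has at most one term: [g] extends [l] by 0 outside [att]. *)
pose g (y : {vspace H}) : C := \sum_(b | enum_val b == y) l 0 b.
have gE b : g (enum_val b) = l 0 b.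
  by rewrite /g (big_pred1 b) // => b' /=; rewrite (inj_eq enum_val_inj).
apply: (@att_op_eigenvalue F H h C sqrtq sqrtqE g a).
  have [b lb] := rV0Pn _ l0.
  by exists (enum_val b); rewrite ?enum_valP // gE.
move=> f; rewrite [LHS]big_enum_val [X in _ * X]big_enum_val mulr_sumr /=.
under eq_bigr do rewrite gE -q_adjacency_sum mulr_sumr.
rewrite exchange_big /=; apply: eq_bigr => b _.
have /rowP/(_ b) := lA; rewrite [LHS]mxE [RHS]mxE => lAb.
by rewrite gE mulrA -lAb mulr_suml; apply: eq_bigr => c _; rewrite mulrA.
Qed.

Lemma eigenvalue_att_op (f : {vspace H} -> C) a :
  (exists2 y, y \in att & f y != 0) ->
  (forall y, y \in att -> att_op h f y = a * f y) -> eigenvalue A^T a.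
Proof.
move=> [y yX fy] fE; apply/eigenvalueP; exists (\row_b f (enum_val b)).
  apply/rowP => b; rewrite !mxE -fE ?enum_valP // -q_adjacency_sum.
  by apply: eq_bigr => c _; rewrite mxE [_^T _ _]mxE mulrC.
by apply/rV0Pn; exists (enum_rank_in yX y); rewrite mxE enum_rankK_in.
Qed.

End Matrix.

(** * Real powers of q and the formula for theta *)

Section Theta.
Variables (R : realType) (F : finFieldType).
Local Notation q := (#|F|%:R : R).
Definition sqrt_card : R := q `^ 2^-1.

Lemma sqrt_cardX n : sqrt_card ^+ n = q `^ (n%:R / 2).
Proof. by rewrite mulrC powRrM powR_mulrn // powR_ge0. Qed.

Lemma sqrt_cardE : (sqrt_card%:C%C) ^+ 2 = #|F|%:R :> R[i].
Proof.
by rewrite -rmorphXn sqrt_cardX divff ?pnatr_eq0 // powRr1 // rmorph_nat.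
Qed.

(** With [e = (r + M) / 2 - k] and [i = k - M - r / 2], the two exponents are
    [e + N + M = N - i + M / 2] and [- e = i + M / 2]. *)
Lemma interval_thetaE (N M r k : nat) :
  interval_theta F (sqrt_card%:C%C) (N + M) (r + M) k =
  (theta #|F| N M (k%:R - M%:R - r%:R / 2))%:C%C.
Proof.
have q0 : q != 0 := cardF_neq0 F R.
have qhalfE : qhalf F (sqrt_card%:C%C) (r + M) k = (q `^ ((r + M)%:R / 2 - k%:R))%:C%C.
  rewrite powRB ?q0 ?implybT // powR_mulrn // /qhalf -rmorphXn sqrt_cardX.
  by rewrite fmorph_div rmorphXn rmorph_nat.
set e := _ - _ in qhalfE.
have -> : interval_theta F (sqrt_card%:C%C) (N + M) (r + M) k =
    ((q `^ e * q ^+ (N + M) - (q `^ e)^-1) / (q - 1))%:C%C.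
  by rewrite /interval_theta qhalfE fmorph_div !rmorphB rmorphM fmorphV rmorphXn rmorph_nat rmorph1.
rewrite /theta {qhalfE}/e; congr (_%:C)%C.
rewrite -powRN -powR_mulrn // -powRD ?q0 ?implybT //.
rewrite [RHS]mulrAC [in RHS]mulrBl -!powRD ?q0 ?implybT //.
congr ((_ `^ _ - _ `^ _) / _); rewrite !natrD; lra.
Qed.

End Theta.

(* [eigenvalue] refers to the action on row vectors, so the eigenvalues of A *)
(* acting on column vectors by left multiplication are those of A^T.         *)
Theorem theorem9p6 (R : realType) (F : finFieldType) (N M : nat)
    (H : vectType F) (h : {vspace H}) :
  (0 < N)%N -> (0 < M)%N ->
  \dim {:H} = (N + M)%N -> \dim h = M ->
  let A := q_adjacency h R in
  diagonalizable A /\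
  (forall a : R[i],
     eigenvalue A^T a <->
     exists2 i : R, i \in half_int_range N & a = (theta #|F| N M i)%:C%C).
Proof.
move=> N0 M0 dH dh A; have sqrtqE := sqrt_cardE R F.
split.
  apply: (@q_adjacency_diagonalizable F H h R _ sqrtqE).
  by rewrite realE -(rmorph0 (real_complex R)) !lecR -realE realE powR_ge0.
move=> a; split.
  move=> /(q_adjacency_eigenvalue sqrtqE)[r [k]]; rewrite dH dh => -[/andP[rk kN] ->].
  exists (k%:R - M%:R - r%:R / 2); last exact: interval_thetaE.
  rewrite inE; apply/andP; split.
    by rewrite !mulrBr mulrCA divff ?pnatr_eq0 // mulr1 !rpredB ?rpredM ?natr_int.
  move: rk kN; rewrite -!(ler_nat R) !natrD => rk kN.
  have r0 := ler0n R r; apply/andP; split; lra.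
move=> [i /[!inE]/andP[i2 /andP[i0 iN]] ->].
have /natrP[m mE] : 2 * i \is a Num.nat by rewrite natrEint i2 mulr_ge0.
have mN : (uphalf m <= N)%N.
  by rewrite leq_uphalf_double -(ler_nat R) -mE -mul2n natrM ler_wpM2l.
(* As [m = 2 * i], this is the index of [interval_thetaE] for [r = odd m] and [k = M + uphalf m]. *)
have -> : i = (M + uphalf m)%:R - M%:R - (odd m)%:R / 2.
  have : 2 * i = ((odd m)%:R + 2 * (m./2)%:R).
    by rewrite mE -[in LHS](odd_double_half m) -mul2n natrD natrM.
  rewrite uphalf_half !natrD; lra.
rewrite -interval_thetaE; have kn : (M + uphalf m <= \dim {:H})%N by rewrite dH addnC leq_add2r.
case: (boolP (odd m)) => m_odd.
  have [|f f0 fE] := @att_op_eigenvector_half F H h R[i] _ sqrtqE _ _ kn.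
    by rewrite dh M0 -[X in (X < _)%N]addn0 ltn_add2l uphalf_half m_odd.
  by apply: eigenvalue_att_op f0 _ => y yX; rewrite fE // dH dh add1n.
have [|f f0 fE] := @att_op_eigenvector_int F H h R[i] _ sqrtqE _ _ kn.
  by rewrite dh M0 leq_addr.
by apply: eigenvalue_att_op f0 _ => y yX; rewrite fE // dH dh.
Qed.
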